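(* Let $d\ge 2$, $\eta>0$, $n\ge 1$, and let $u_1^{(1)},\ldots,u_n^{(1)}\in S^{d-1}$ be arbitrary initial opinions. Let $v^{(1)},v^{(2)},\ldots$ be i.i.d. random interventions, each uniformly distributed on $S^{d-1}$, and let $u_i^{(t+1)}=f(u_i^{(t)},v^{(t)})$ for all $1\le i\le n$ and $t\ge 1$. Then, almost surely, there exists a set $J\subseteq\{1,\ldots,n\}$ (possibly depending on the realization) such that the diameter of the set $$\left\{(-1)^{\mathbf{1}[i\in J]}\cdot u_i^{(t)}:\ i\in\{1,\ldots,n\}\right\}$$ converges to zero as $t\to\infty$.
   Context: $S^{d-1}$ is the Euclidean unit sphere in $\mathbb{R}^d$, $\langle\cdot,\cdot\rangle$ the standard inner product, $\|\cdot\|$ the Euclidean norm. For a fixed parameter $\eta>0$, applying an intervention $v\in S^{d-1}$ to an opinion $u\in S^{d-1}$ gives the updated opinion $f(u,v)=w/\|w\|$, where $w=u+\eta\langle u,v\rangle v$ (here $\|w\|\ge 1$). At each time step the same intervention $v^{(t)}$ is applied to all opinions. $\mathbf{1}[\cdot]$ denotes the indicator (1 if true, 0 if false). Diameter is with respect to the Euclidean distance. *)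

(* Defs.v *)
From HB Require Import structures.
From mathcomp Require Import all_boot all_order all_algebra.
From mathcomp Require Import all_classical all_reals all_analysis.

Set Implicit Arguments.
Unset Strict Implicit.
Unset Printing Implicit Defensive.

Import Order.TTheory GRing.Theory Num.Theory.
Import numFieldNormedType.Exports.

Local Open Scope classical_set_scope.
Local Open Scope ring_scope.

Section Euclidean.
Context {R : realType} {d : nat}.
Implicit Types (u v : 'rV[R]_d) (A : set 'rV[R]_d).

Definition dotp u v : R := \sum_(i < d) u 0 i * v 0 i.

(* The norm `|u| of the library on row vectors is the max norm. *)
Definition enorm u : R := Num.sqrt (dotp u u).

(* S^{d-1} in R^d *)
Definition sphere : set 'rV[R]_d := [set u | enorm u = 1].

(* [sup] is the usual supremum on nonempty bounded sets, and 0 otherwise. *)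
Definition ediam A : R := sup [set enorm (x - y) | x in A & y in A].

Definition orthogonal_mx (Q : 'M[R]_d) : Prop := Q *m Q^T = 1%:M.

End Euclidean.

Arguments sphere : clear implicits.

(* R^d with its Borel sigma-algebra *)
Notation borelRV R d := (g_sigma_algebraType (@open 'rV[R]_d)).

(* The uniform distribution on S^{d-1}, as a Borel probability measure on R^d:
   the one that is concentrated on the sphere and invariant under all linear
   isometries of R^d. *)
Definition uniform_on_sphere (R : realType) (d : nat)
    (mu : probability (borelRV R d) R) : Prop :=
  mu (sphere R d) = 1%E /\
  forall Q : 'M[R]_d, orthogonal_mx Q ->
    forall A : set (borelRV R d), measurable A ->
      mu [set x : 'rV[R]_d | A (x *m Q)] = mu A.

(* The product rule over every finite subfamily *)
Definition mutually_independent (R : realType) (dO dS : measure_display)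
    (Omega : measurableType dO) (S : measurableType dS)
    (P : probability Omega R) (I : eqType) (X : I -> {RV P >-> S}) : Prop :=
  forall (s : seq I) (A : I -> set S), uniq s ->
    (forall i, measurable (A i)) ->
    (P (\bigcap_(i in [set` s]) (X i @^-1` A i)) =
     \prod_(i <- s) P (X i @^-1` A i))%E.

Definition iid_with_law (R : realType) (dO dS : measure_display)
    (Omega : measurableType dO) (S : measurableType dS)
    (P : probability Omega R) (I : eqType) (X : I -> {RV P >-> S})
    (mu : probability S R) : Prop :=
  mutually_independent X /\
  forall i (A : set S), measurable A -> distribution P (X i) A = mu A.

Section Dynamics.
Context {R : realType} {d : nat}.
Variable eta : R.

Definition update (u v : 'rV[R]_d) : 'rV[R]_d :=
  let w := u + (eta * dotp u v) *: v in (enorm w)^-1 *: w.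

(* Times are shifted by one: index t stands for time t + 1. *)
Fixpoint opinion (v : nat -> 'rV[R]_d) (u0 : 'rV[R]_d) (t : nat) : 'rV[R]_d :=
  if t is t'.+1 then update (opinion v u0 t') (v t') else u0.

End Dynamics.

(* Main.v *)
Require Import Defs.
From HB Require Import structures.
From mathcomp Require Import all_boot all_order all_algebra.
From mathcomp Require Import all_classical all_reals all_analysis.
From mathcomp Require Import measurable_realfun ring lra.

Set Implicit Arguments.
Unset Strict Implicit.
Unset Printing Implicit Defensive.

Import Order.TTheory GRing.Theory Num.Theory.
Import numFieldNormedType.Exports.

Local Open Scope classical_set_scope.
Local Open Scope ring_scope.

(* Write c = 2 eta + eta^2 and let x, a, b be <u,u'>, <u,v>, <u',v>. For unit
   vectors one step multiplies the squared sine 1 - x^2 by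
     (1 + c (a^2 + y^2)) / ((1 + c a^2) (1 + c b^2)),  y = <e,v>,
   where (u, e) is an orthonormal basis of span(u, u'). When v is uniform, b and
   y have the same law, so the mean logarithm of this ratio is
     - E [ln (1 + c a^2) + ln (1 + c y^2) - ln (1 + c (a^2 + y^2))],
   a negative constant independent of (u, u') by invariance under isometries.
   Hence (1 - x^2)^alpha contracts in mean by a fixed factor for small alpha > 0,
   so it is almost surely summable along the dynamics and tends to 0. Once x^2 is
   close to 1 its sign cannot change any more, so x tends to 1 or to -1; J collects
   the opinions that become opposite to the first one. *)

(** * Inner product algebra and transitivity of the orthogonal group *)

Section InnerProduct.
Context {R : realType} {d : nat}.
Implicit Types (u v w e f : 'rV[R]_d) (a : R) (Q : 'M[R]_d).

Lemma dotpC u v : dotp u v = dotp v u.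
Proof. by apply: eq_bigr => i _; rewrite mulrC. Qed.

Lemma dotpDl u v w : dotp (u + v) w = dotp u w + dotp v w.
Proof. by rewrite -big_split; apply: eq_bigr => i _; rewrite mxE mulrDl. Qed.

Lemma dotpZl a u v : dotp (a *: u) v = a * dotp u v.
Proof. by rewrite /dotp mulr_sumr; apply: eq_bigr => i _; rewrite mxE mulrA. Qed.

Lemma dotpDr u v w : dotp u (v + w) = dotp u v + dotp u w.
Proof. by rewrite !(dotpC u) dotpDl. Qed.

Lemma dotpZr a u v : dotp u (a *: v) = a * dotp u v.
Proof. by rewrite !(dotpC u) dotpZl. Qed.

Lemma dotpNl u v : dotp (- u) v = - dotp u v.
Proof. by rewrite -scaleN1r dotpZl mulN1r. Qed.

Lemma dotpNr u v : dotp u (- v) = - dotp u v.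
Proof. by rewrite !(dotpC u) dotpNl. Qed.

Definition dotpE := (dotpDl, dotpDr, dotpZl, dotpZr, dotpNl, dotpNr).

Lemma dotp_ge0 u : 0 <= dotp u u.
Proof. by apply: sumr_ge0 => i _; rewrite -expr2 sqr_ge0. Qed.

Lemma dotp_eq0 u : dotp u u = 0 -> u = 0.
Proof.
move=> u0; apply/rowP => i; rewrite mxE; apply/eqP; rewrite -sqrf_eq0 expr2.
by apply/eqP; apply: (psumr_eq0P _ u0) => // j _; rewrite -expr2 sqr_ge0.
Qed.

Lemma sphereP u : sphere R d u <-> dotp u u = 1.
Proof.
rewrite /sphere /= /enorm; split=> [h|->]; last exact: sqrtr1.
by rewrite -(sqr_sqrtr (dotp_ge0 u)) h expr1n.
Qed.

Lemma dotp_sqr_le1 u v : dotp u u = 1 -> dotp v v = 1 -> dotp u v ^+ 2 <= 1.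
Proof.
move=> u1 v1; have := dotp_ge0 (u - dotp u v *: v).
rewrite !dotpE u1 v1 (dotpC v u); nra.
Qed.

Lemma dotp_delta (i j : 'I_d) :
  dotp (delta_mx 0 i : 'rV[R]_d) (delta_mx 0 j) = (i == j)%:R.
Proof.
rewrite /dotp (bigD1 i) //= big1 => [|k ki]; rewrite !mxE ?eqxx /=.
  by rewrite mul1r addr0.
by rewrite (negbTE ki) mul0r.
Qed.

Lemma dotp_deltal (i : 'I_d) u : dotp (delta_mx 0 i) u = u 0 i.
Proof.
rewrite /dotp (bigD1 i) //= big1 => [|k ki]; rewrite !mxE ?eqxx /=.
  by rewrite mul1r addr0.
by rewrite (negbTE ki) mul0r.
Qed.

Lemma dotp_mulmx u v : u *m v^T = (dotp u v)%:M.
Proof.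
apply/matrixP => i j; rewrite !ord1 !mxE eqxx mulr1n.
by apply: eq_bigr => k _; rewrite mxE.
Qed.

Lemma dotp_mulmxl Q u v : dotp (u *m Q) v = dotp u (v *m Q^T).
Proof.
have : ((dotp (u *m Q) v)%:M : 'M[R]_1) = (dotp u (v *m Q^T))%:M.
  by rewrite -!dotp_mulmx trmx_mul trmxK mulmxA.
by move/matrixP => /(_ 0 0); rewrite !mxE eqxx !mulr1n.
Qed.

Lemma orthogonal_trmx Q : orthogonal_mx Q -> orthogonal_mx Q^T.
Proof. by rewrite /orthogonal_mx trmxK; exact: mulmx1C. Qed.

Lemma orthogonal_dotp Q u v :
  orthogonal_mx Q -> dotp (u *m Q) (v *m Q) = dotp u v.
Proof. by move=> Qo; rewrite dotp_mulmxl -mulmxA Qo mulmx1. Qed.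

Lemma orthogonal_mulmx Q Q' :
  orthogonal_mx Q -> orthogonal_mx Q' -> orthogonal_mx (Q *m Q').
Proof.
move=> Qo Q'o; rewrite /orthogonal_mx trmx_mul mulmxA -(mulmxA Q) Q'o.
by rewrite mulmx1.
Qed.

(* A Householder reflection along [e - f]. *)
Lemma orthogonal_transitive1 e f : dotp e e = 1 -> dotp f f = 1 ->
  exists Q, [/\ orthogonal_mx Q, e *m Q = f &
    forall z, dotp z e = 0 -> dotp z f = 0 -> z *m Q = z].
Proof.
move=> e1 f1; have [<-|ef] := eqVneq e f.
  exists 1%:M; split; rewrite ?mulmx1//; first by rewrite /orthogonal_mx trmx1 mulmx1.
  by move=> z _ _; rewrite mulmx1.
pose h := e - f; pose N := dotp h h.
have N0 : N != 0.
  by apply/eqP => /dotp_eq0/eqP; rewrite subr_eq0 (negbTE ef).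
have NE : N = 2 - 2 * dotp e f.
  by rewrite /N /h !dotpE e1 f1 (dotpC f e); ring.
pose Q : 'M[R]_d := 1%:M - (2 / N) *: (h^T *m h).
have QE z : z *m Q = z - (2 / N * dotp z h) *: h.
  rewrite /Q mulmxBr mulmx1 -scalemxAr mulmxA dotp_mulmx mul_scalar_mx.
  by rewrite scalerA.
have QT : Q^T = Q.
  by rewrite /Q linearB /= trmx1 linearZ /= trmx_mul trmxK.
exists Q; split.
(* [Q] is symmetric, so orthogonality says that reflecting twice is the identity; this is checked
   row by row. *)
- rewrite /orthogonal_mx QT; apply/row_matrixP => i.
  rewrite row_mul; set z := row i Q.
  have -> : z = row i 1%:M *m Q by rewrite /z -row_mul mul1mx.
  rewrite QE QE; set y := row i _; rewrite (dotpDl y) dotpNl dotpZl -/N.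
  rewrite -addrA -opprD -scalerDl [X in X *: _](_ : _ = 0); last by field.
  by rewrite scale0r subr0.
- rewrite QE /h dotpE dotpNr e1.
  have -> : 2 / N * (1 - dotp e f) = 1.
    by rewrite NE; field; rewrite -NE.
  by rewrite scale1r opprB addrC subrK.
- by move=> z ze zf; rewrite QE /h !dotpE ze zf subr0 mulr0 scale0r subr0.
Qed.

Definition orthonormal_pair e f :=
  [/\ dotp e e = 1, dotp f f = 1 & dotp e f = 0].

(** Two reflections suffice: after the first has sent [e1] to [f1], the second, taking the image of
    [e2] to [f2], fixes [f1] because [f1] is orthogonal to both of these vectors. *)
Lemma orthogonal_transitive2 e1 e2 f1 f2 :
  orthonormal_pair e1 e2 -> orthonormal_pair f1 f2 ->
  exists Q, [/\ orthogonal_mx Q, e1 *m Q = f1 & e2 *m Q = f2].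
Proof.
move=> [e11 e22 e12] [f11 f22 f12].
have [Q [Qo Qe _]] := orthogonal_transitive1 e11 f11.
have g1 : dotp (e2 *m Q) (e2 *m Q) = 1 by rewrite orthogonal_dotp.
have [Q' [Q'o Q'e Q'z]] := orthogonal_transitive1 g1 f22.
exists (Q *m Q'); split; first exact: orthogonal_mulmx.
- by rewrite mulmxA Qe Q'z// -Qe orthogonal_dotp.
- by rewrite mulmxA Q'e.
Qed.

End InnerProduct.

(** * Effect of one intervention on the angle between two opinions *)

Section Update.
Context {R : realType} {d : nat}.
Variable eta : R.
Hypothesis eta_gt0 : 0 < eta.
Implicit Types (u v w : 'rV[R]_d).

(* [|u + eta <u,v> v|^2 = 1 + vgain v * <u,v>^2] for unit [u] *)
Let vgain v : R := 2 * eta + eta ^+ 2 * dotp v v.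

Let vgain_gt0 v : 0 < vgain v.
Proof.
rewrite ltr_wpDr ?mulr_gt0//; apply: mulr_ge0; rewrite ?dotp_ge0// sqr_ge0//.
Qed.

Let den_ge1 v (a : R) : 1 <= 1 + vgain v * a ^+ 2.
Proof. by rewrite lerDl mulr_ge0 ?sqr_ge0// ltW. Qed.

Let den_gt0 v (a : R) : 0 < 1 + vgain v * a ^+ 2.
Proof. exact: lt_le_trans ltr01 (den_ge1 v a). Qed.

Lemma dotp_update u u' v : dotp u u = 1 -> dotp u' u' = 1 ->
  dotp (update eta u v) (update eta u' v) =
  (dotp u u' + vgain v * dotp u v * dotp u' v) /
  (Num.sqrt (1 + vgain v * dotp u v ^+ 2) *
   Num.sqrt (1 + vgain v * dotp u' v ^+ 2)).
Proof.
move=> u1 u'1.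
(* This expansion yields the numerator and, when [w] and [w'] coincide, both squared norms of the
   denominator. *)
have E w w' : dotp (w + (eta * dotp w v) *: v) (w' + (eta * dotp w' v) *: v) =
    dotp w w' + vgain v * dotp w v * dotp w' v.
  by rewrite !dotpE (dotpC v w') /vgain; ring.
rewrite /update dotpZl dotpZr /enorm !E u1 u'1 -!mulrA -!expr2.
by rewrite [RHS]mulrC invfM -!mulrA.
Qed.

Lemma sphere_update u v : sphere R d u -> sphere R d (update eta u v).
Proof.
move=> /sphereP u1; apply/sphereP; rewrite dotp_update// u1 -expr2.
rewrite sqr_sqrtr ?(ltW (den_gt0 _ _))// -mulrA -expr2 divff//.
by rewrite gt_eqF.
Qed.

(** With a, b, x for the products <u,v>, <u',v>, <u,u'> and c for [vgain v], the term c^2 a^2 b^2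
    cancels in the difference of (1 + c a^2)(1 + c b^2) and (x + c a b)^2. *)
Lemma sin2_update u u' v : dotp u u = 1 -> dotp u' u' = 1 ->
  1 - dotp (update eta u v) (update eta u' v) ^+ 2 =
  (1 - dotp u u' ^+ 2 + vgain v * (dotp u v ^+ 2 + dotp u' v ^+ 2
     - 2 * dotp u v * dotp u' v * dotp u u')) /
  ((1 + vgain v * dotp u v ^+ 2) * (1 + vgain v * dotp u' v ^+ 2)).
Proof.
move=> u1 u'1; rewrite dotp_update// expr_div_n exprMn.
rewrite !sqr_sqrtr ?(ltW (den_gt0 _ _))//.
by field; rewrite !gt_eqF.
Qed.

End Update.

(** * Independence of the current state of a driven chain from the next input *)

Section DrivenChain.
Context {R : realType} {dO dS dT : measure_display}.
Context {Omega : measurableType dO} {S : measurableType dS}.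
Context {T : measurableType dT}.
Variables (P : probability Omega R) (X : nat -> {RV P >-> S}).
Variables (F : T * S -> T) (x0 : T).
Hypothesis mF : measurable_fun setT F.
Hypothesis indepX : mutually_independent X.

(** [chain t] reads only the inputs of index below [t], so [X t] is the fresh input of the next
    step. *)
Fixpoint chain (t : nat) (omega : Omega) : T :=
  if t is t'.+1 then F (chain t' omega, X t' omega) else x0.

Lemma measurable_chain t : measurable_fun setT (chain t).
Proof.
elim: t => [|t IH] /=; first exact: measurable_cst.
apply: (measurableT_comp mF); apply: measurable_fun_pair => //.
Qed.

Local Open Scope ereal_scope.

Let measurable_cylinder (s : seq nat) (A : nat -> set S) :
  (forall i, measurable (A i)) ->
  measurable (\bigcap_(i in [set` s]) (X i @^-1` A i)).
Proof.
move=> mA; apply: bigcap_measurableType.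
by move=> i _; rewrite -[X in measurable X]setTI; exact: measurable_funPT.
Qed.

(* Induction on [t]: pushing [X t] from the cylinder into the state reduces the
   step to uniqueness of measures agreeing on rectangles of [T * S]. *)
Lemma chain_independent t (s : seq nat) (B : set T) (A : nat -> set S) :
  measurable B -> uniq s -> (forall i, i \in s -> (t <= i)%N) ->
  (forall i, measurable (A i)) ->
  P (chain t @^-1` B `&` \bigcap_(i in [set` s]) (X i @^-1` A i)) =
  P (chain t @^-1` B) * P (\bigcap_(i in [set` s]) (X i @^-1` A i)).
Proof.
elim: t s B A => [|t IH] s B A mB us ts mA.
  have [Bx|Bx] := pselect (B x0).
    have -> : chain 0 @^-1` B = setT by apply/seteqP; split.
    by rewrite setTI probability_setT mul1e.
  have -> : chain 0 @^-1` B = set0 by apply/seteqP; split.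
  by rewrite set0I measure0 mul0e.
pose W omega := (chain t omega, X t omega).
have mW : measurable_fun setT W.
  by apply: measurable_fun_pair => //; exact: measurable_chain.
set C := \bigcap_(i in _) _.
have mC : measurable C by exact: measurable_cylinder.
pose WM : {mfun Omega >-> (T * S)%type} := HB.pack W (isMeasurableFun.Build _ _ _ _ _ mW).
have [m1 m1E] : exists m1 : {measure set (T * S) -> \bar R},
    forall D, m1 D = P (W @^-1` D `&` C).
  by unshelve eexists (pushforward (mrestr P mC) W).
pose PC : {nonneg R} := NngNum (fine_ge0 (measure_ge0 P C)).
have PCE : (PC%:num)%:E = P C.
  by rewrite /= fineK// fin_num_measure.
pose m2 : {measure set (T * S) -> \bar R} := mscale PC (distribution P WM).
(* [m1 D] is P(W in D and C) and [m2 D] is P(C) P(W in D); their equality at the preimage of [B]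
   under [F] is the claim for [t.+1]. *)
suff m12 : forall D, measurable D -> m1 D = m2 D.
  have mFB : measurable (F @^-1` B) by rewrite -[X in measurable X]setTI; exact: mF.
  have := m12 _ mFB; rewrite m1E /m2 /= /mscale /= => ->.
  by rewrite PCE muleC.
pose G := [set D | exists A0 : set T, measurable A0 /\
   exists2 A1 : set S, measurable A1 & D = A0 `*` A1].
apply: (measure_unique G (fun=> setT)) => //.
- rewrite measurable_prod_measurableType; congr (<<s _ >>).
  apply/seteqP; split => D.
    by move=> [A0 mA0 [A1 mA1 <-]]; exists A0; split => //; exists A1.
  by move=> [A0 [mA0 [A1 mA1 ->]]]; exists A0 => //; exists A1.
- move=> _ _ [A0 [mA0 [A1 mA1 ->]]] [B0 [mB0 [B1 mB1 ->]]].
  exists (A0 `&` B0); split; first exact: measurableI.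
  by exists (A1 `&` B1); [exact: measurableI|rewrite setXI].
- move=> _; exists setT; split => //; exists setT => //.
  by rewrite setXTT.
- by rewrite bigcup_const.
- move=> _ [A0 [mA0 [A1 mA1 ->]]].
  rewrite m1E /m2 /= /mscale /= fineK ?fin_num_measure//.
  (* Every index in [s] exceeds [t], so prescribing [A1] at [t] leaves [C] unchanged. The induction
     hypothesis is then used for [t :: s] and for [[:: t]], and independence of the inputs separates
     [X t] from [C]. *)
  pose A' i := if i == t then A1 else A i.
  have mA' i : measurable (A' i) by rewrite /A'; case: ifP.
  have ts' : t \notin s.
    by apply/negP => /ts; rewrite ltnn.
  have CE : \bigcap_(i in [set` s]) (X i @^-1` A' i) = C.
    apply: eq_bigcapr => i /= si; rewrite /A'; case: eqP => // it.
    by rewrite -it si in ts'.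
  have consE Z : \bigcap_(i in [set` t :: s]) (X i @^-1` Z i) =
       X t @^-1` Z t `&` \bigcap_(i in [set` s]) (X i @^-1` Z i).
    by rewrite !bigcap_seq big_cons.
  have At : A' t = A1 by rewrite /A' eqxx.
  have IHt := IH (t :: s) A0 A' mA0.
  rewrite consE At CE in IHt.
  have -> : W @^-1` (A0 `*` A1) `&` C =
     chain t @^-1` A0 `&` (X t @^-1` A1 `&` C) by rewrite setIA.
  rewrite IHt//; last 2 first.
  + by rewrite /= ts'.
  + by move=> i; rewrite inE => /orP[/eqP->//|/ts/ltnW].
  have -> : distribution P WM (A0 `*` A1) = P ( chain t @^-1` A0 `&` X t @^-1` A1) by [].
  have := IH [:: t] A0 A' mA0.
  rewrite set_cons1 bigcap_set1 At => ->//; last first.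
    by move=> i; rewrite inE => /eqP->.
  have -> : P (X t @^-1` A1 `&` C) = P (X t @^-1` A1) * P C.
    have := indepX (s := t :: s) (A := A').
    rewrite consE At CE => ->//=; last by rewrite ts'.
    rewrite big_cons At; congr (_ * _).
    have := indepX us mA; rewrite -/C => ->.
    by apply: eq_big_seq => i si; rewrite /A'; case: eqP => // it; rewrite -it si in ts'.
  by rewrite muleA muleC.
- move=> _; rewrite m1E.
  have -> : W @^-1` setT `&` C = C by rewrite preimage_setT setTI.
  exact: le_lt_trans (probability_le1 _ mC) (ltry _).
Qed.

(** Independence makes the joint law of [chain t] and [X t] a product measure, with second factor
    [mu]; Tonelli then integrates the fresh input first. *)
Lemma integral_chain t (mu : probability S R) (f : T * S -> \bar R) :
  (forall A, measurable A -> distribution P (X t) A = mu A) ->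
  measurable_fun [set: T * S] f -> (forall z, 0 <= f z) ->
  \int[P]_omega f (chain t omega, X t omega) =
  \int[P]_omega \int[mu]_y f (chain t omega, y).
Proof.
move=> Xmu mf f0.
pose W omega := (chain t omega, X t omega).
have mW : measurable_fun setT W.
  by apply: measurable_fun_pair => //; exact: measurable_chain.
pose UM : {mfun Omega >-> T} :=
  HB.pack (chain t) (isMeasurableFun.Build _ _ _ _ _ (measurable_chain t)).
pose WM : {mfun Omega >-> (T * S)%type} := HB.pack W (isMeasurableFun.Build _ _ _ _ _ mW).
rewrite -[LHS](ge0_integral_distribution WM)//.
have mfF : measurable_fun setT (fubini_F mu f).
  exact: measurable_fun_fubini_tonelli_F.
rewrite -[RHS](ge0_integral_distribution UM (f := fubini_F mu f))//; last first.
  by move=> y; exact: integral_ge0.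
rewrite -(fubini_tonelli1 (m1 := distribution P UM) (m2 := mu))//.
apply: eq_measure_integral => D mD _; apply/esym.
apply: product_measure_unique => // A B mA mB.
transitivity (distribution P UM A * distribution P (X t) B); last first.
  by congr (_ * _); exact: Xmu.
rewrite /= /distribution /pushforward.
have := @chain_independent t [:: t] A (fun=> B) mA.
rewrite set_cons1 bigcap_set1; apply => //.
by move=> i; rewrite inE => /eqP->.
Qed.

End DrivenChain.

(** * Measurability of vector-valued maps through their coordinates *)

Section RowMeasurability.
Context {R : realType} {d : nat}.

(* It generates the Borel sets, but only one inclusion is needed: opinions are
   viewed as random elements of [coordRV], where measurability of a map can be
   checked on coordinates. *)
Definition coordinate_sets : set (set 'rV[R]_d) :=
  \bigcup_(i in [set: 'I_d])
    preimage_set_system setT (fun u : 'rV[R]_d => u 0 i) measurable.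

Definition coordRV := g_sigma_algebraType coordinate_sets.

(** Stated without a sigma-algebra on the target, so that opinions in [coordRV] and interventions in
    [borelRV] are handled alike. *)
Definition rmeasurable {d1} {T : measurableType d1} (f : T -> 'rV[R]_d) :=
  forall i, measurable_fun setT (fun x => f x 0 i).

Lemma rmeasurable_borel : rmeasurable (fun x : borelRV R d => x).
Proof.
move=> i; apply: (measurability _ (RGenOpens.measurableE R)).
move=> _ [_ [a [b ->]] <-]; rewrite setTI.
apply: sub_sigma_algebra.
have /continuousP := @coord_continuous R 1 d 0 i.
by apply; exact: interval_open.
Qed.

Lemma rmeasurable_coordRV : rmeasurable (fun x : coordRV => x).
Proof.
by move=> i _ A mA; apply: sub_sigma_algebra; exists i => //; exists A.
Qed.

Lemma measurable_to_coordRV {d1} {T : measurableType d1} (f : T -> coordRV) :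
  rmeasurable f -> measurable_fun setT f.
Proof.
move=> mf; apply: (measurability (coordinate_sets : set (set coordRV))) => //.
move=> _ [B [i _ [A mA <-]] <-]; rewrite !setTI.
by rewrite -[X in measurable X]setTI; exact: mf.
Qed.

Section Operations.
Context {d1} {T : measurableType d1}.
Implicit Types f g : T -> 'rV[R]_d.

Lemma rmeasurable_cst u : rmeasurable (fun _ : T => u).
Proof. by move=> i; exact: measurable_cst. Qed.

Lemma rmeasurableD f g : rmeasurable f -> rmeasurable g ->
  rmeasurable (fun x => f x + g x).
Proof.
move=> mf mg i; under [X in measurable_fun _ X]eq_fun do rewrite mxE.
exact: measurable_funD.
Qed.

Lemma rmeasurableZ (a : T -> R) f : measurable_fun setT a -> rmeasurable f ->
  rmeasurable (fun x => a x *: f x).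
Proof.
move=> ma mf i; under [X in measurable_fun _ X]eq_fun do rewrite mxE.
exact: measurable_funM.
Qed.

Lemma measurable_dotp f g : rmeasurable f -> rmeasurable g ->
  measurable_fun setT (fun x => dotp (f x) (g x)).
Proof.
by move=> mf mg; apply: measurable_sum => i; exact: measurable_funM.
Qed.

Lemma rmeasurable_update (eta : R) f g : rmeasurable f -> rmeasurable g ->
  rmeasurable (fun x => update eta (f x) (g x)).
Proof.
move=> mf mg; rewrite /update.
set w := fun x => f x + (eta * dotp (f x) (g x)) *: g x.
have mw : rmeasurable w.
  apply: rmeasurableD => //; apply: rmeasurableZ => //.
  by apply: measurable_funM => //; exact: measurable_dotp.
(* Power functions are measurable, and the identity also holds when [w x] is zero, where both sides
   are 0. *)
have norm_powR x : (enorm (w x))^-1 = dotp (w x) (w x) `^ (- 2^-1).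
  by rewrite powRN powR12_sqrt// dotp_ge0.
apply: (@rmeasurableZ (fun x => (enorm (w x))^-1) w) => //.
under [X in measurable_fun _ X]eq_fun do rewrite norm_powR.
by apply: (measurableT_comp (measurable_powR _)); exact: measurable_dotp.
Qed.

End Operations.
End RowMeasurability.
Arguments coordRV : clear implicits.

(** * Consequences of the rotation invariance of the uniform law *)

Section UniformLaw.
Context {R : realType} {d : nat}.
Variable mu : probability (borelRV R d) R.
Hypothesis hmu : uniform_on_sphere mu.
Implicit Types (e f u : 'rV[R]_d).

Let aeF : Filter (nbhs (almost_everywhere mu)).
Proof. exact: ae_filter_ringOfSetsType. Qed.

Lemma measurable_dotp_borel e :
  measurable_fun setT (fun v : borelRV R d => dotp e (v : 'rV[R]_d)).
Proof.
apply: measurable_dotp; first exact: rmeasurable_cst.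
exact: rmeasurable_borel.
Qed.

Lemma ae_dotp_eq1 : \forall v \ae mu, dotp (v : 'rV[R]_d) v = 1.
Proof.
have mS : measurable (sphere R d : set (borelRV R d)).
  have -> : sphere R d = (fun v : borelRV R d => dotp (v : 'rV[R]_d) v) @^-1` [set 1].
    by apply/seteqP; split => v; rewrite /= sphereP.
  rewrite -[X in measurable X]setTI.
  by apply: measurable_dotp => //; exact: rmeasurable_borel.
exists (~` sphere R d); split.
- exact: measurableC.
- by have [mu1 _] := hmu; rewrite /= probability_setC// mu1 subee.
- by move=> v /= v1 /sphereP.
Qed.

(** By adjunction [Q] moves from the fixed vectors to the transpose acting on [v], and invariance of
    [mu] shows that the two pairs of coordinates have the same law. *)
Lemma integral_orthogonal (h : R * R -> R) (Q : 'M[R]_d) e1 e2 :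
  measurable_fun setT h -> (forall z, 0 <= h z) -> orthogonal_mx Q ->
  (\int[mu]_v (h (dotp (e1 *m Q) (v : 'rV[R]_d), dotp (e2 *m Q) (v : 'rV[R]_d)))%:E =
   \int[mu]_v (h (dotp e1 (v : 'rV[R]_d), dotp e2 (v : 'rV[R]_d)))%:E)%E.
Proof.
move=> mh h0 Qo.
pose T f1 f2 (v : borelRV R d) := (dotp f1 (v : 'rV[R]_d), dotp f2 (v : 'rV[R]_d)).
have mT f1 f2 : measurable_fun setT (T f1 f2).
  by apply: measurable_fun_pair; exact: measurable_dotp_borel.
pose TM f1 f2 : {mfun borelRV R d >-> (R * R)%type} :=
  HB.pack (T f1 f2) (isMeasurableFun.Build _ _ _ _ _ (mT f1 f2)).
have hE f1 f2 : (\int[mu]_v (h (T f1 f2 v))%:E =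
    \int[distribution mu (TM f1 f2)]_z (h z)%:E)%E.
  rewrite (ge0_integral_distribution (TM f1 f2) (f := fun z => (h z)%:E))//.
  exact/measurable_EFinP.
rewrite [LHS]hE [RHS]hE; apply: eq_measure_integral => B mB _.
have [_ inv] := hmu.
have := inv _ (orthogonal_trmx Qo) (T e1 e2 @^-1` B).
rewrite -[X in measurable X]setTI => /(_ (mT _ _ measurableT _ mB)) muB.
apply: etrans muB; rewrite /distribution /pushforward /=; congr (mu _).
by apply/seteqP; split => v; rewrite /= /T !dotp_mulmxl.
Qed.

Lemma integral_orthonormal (h : R * R -> R) e1 e2 f1 f2 :
  measurable_fun setT h -> (forall z, 0 <= h z) ->
  orthonormal_pair e1 e2 -> orthonormal_pair f1 f2 ->
  (\int[mu]_v (h (dotp e1 (v : 'rV[R]_d), dotp e2 (v : 'rV[R]_d)))%:E =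
   \int[mu]_v (h (dotp f1 (v : 'rV[R]_d), dotp f2 (v : 'rV[R]_d)))%:E)%E.
Proof.
move=> mh h0 eo fo; have [Q [Qo <- <-]] := orthogonal_transitive2 eo fo.
by rewrite integral_orthogonal.
Qed.

Lemma integral_unit (h : R -> R) e f :
  measurable_fun setT h -> (forall z, 0 <= h z) ->
  dotp e e = 1 -> dotp f f = 1 ->
  (\int[mu]_v (h (dotp e (v : 'rV[R]_d)))%:E =
   \int[mu]_v (h (dotp f (v : 'rV[R]_d)))%:E)%E.
Proof.
move=> mh h0 e1 f1; have [Q [Qo <- _]] := orthogonal_transitive1 e1 f1.
rewrite (integral_orthogonal (h := h \o fst) e e)//=.
exact: measurableT_comp.
Qed.

Section Positivity.
Variable psi : R * R -> R.
Hypotheses (mpsi : measurable_fun setT psi) (psi_ge0 : forall z, 0 <= psi z).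
Hypothesis psi_gt0 : forall x y, x != 0 -> y != 0 -> 0 < psi (x, y).

Let ae_orthogonal e1 e2 : orthonormal_pair e1 e2 ->
  (\int[mu]_v (psi (dotp e1 (v : 'rV[R]_d), dotp e2 (v : 'rV[R]_d)))%:E = 0)%E ->
  \forall v \ae mu, dotp e1 (v : 'rV[R]_d) = 0.
Proof.
move=> eo psi0.
have ae_or f1 f2 : orthonormal_pair f1 f2 ->
    \forall v \ae mu, dotp f1 (v : 'rV[R]_d) * dotp f2 (v : 'rV[R]_d) = 0.
  move=> fo.
  have mf : measurable_fun [set: borelRV R d]
      (fun v => (psi (dotp f1 (v : 'rV[R]_d), dotp f2 (v : 'rV[R]_d)))%:E).
    apply/measurable_EFinP; apply: (measurableT_comp mpsi).
    by apply: measurable_fun_pair; exact: measurable_dotp_borel.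
  have /(ae_eq_integral_abs mu measurableT mf) : (\int[mu]_v
      `|(psi (dotp f1 (v : 'rV[R]_d), dotp f2 (v : 'rV[R]_d)))%:E| = 0)%E.
    under eq_integral do rewrite gee0_abs ?lee_fin//.
    by rewrite -[LHS](integral_orthonormal mpsi psi_ge0 eo fo).
  apply: filterS => v /(_ I) [psiv]; apply/eqP; apply: contraT.
  rewrite mulf_eq0 negb_or => /andP[x0 y0].
  by have := psi_gt0 x0 y0; rewrite psiv ltxx.
have [e11 e22 e12] := eo.
have e21 : dotp e2 e1 = 0 by rewrite dotpC.
(* The 3-4-5 triangle gives a rotation with rational entries whose axes differ from the original
   ones. *)
have ro : orthonormal_pair ((3 / 5) *: e1 + (4 / 5) *: e2)
    ((4 / 5) *: e1 - (3 / 5) *: e2).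
  by split; rewrite !dotpE ?e11 ?e22 ?e12 ?e21; field.
move: (ae_or _ _ eo) (ae_or _ _ ro); apply: (@filterS2 _ _ aeF) => v.
rewrite !dotpE; move: (dotp e1 v) (dotp e2 v) => x y /= /eqP.
rewrite mulf_eq0 => /orP[/eqP//|/eqP->] h.
(* With y = 0 the rotated product reduces to (12/25) x^2. *)
have : x ^+ 2 = 0 by lra.
by move=> /eqP; rewrite sqrf_eq0 => /eqP.
Qed.

(* If the integral vanished, then xy = 0 and (3x + 4y)(4x - 3y) = 0 almost
   everywhere by invariance, so every coordinate would vanish. *)
Lemma integral_orthonormal_gt0 e1 e2 : (2 <= d)%N -> orthonormal_pair e1 e2 ->
  (0 < \int[mu]_v (psi (dotp e1 (v : 'rV[R]_d), dotp e2 (v : 'rV[R]_d)))%:E)%E.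
Proof.
move=> d2 eo; rewrite lt_def integral_ge0 ?andbT; last first.
  by move=> v _; rewrite lee_fin.
apply/negP => /eqP psi0.
have coord0 (i : 'I_d) : \forall v \ae mu, (v : 'rV[R]_d) 0 i = 0.
  have [j ji] : exists j : 'I_d, j != i.
    have : [exists j : 'I_d, j != i].
      apply: contraLR d2; rewrite negb_exists => /forallP ij.
      rewrite -ltnNge ltnS -[d]card_ord; apply/fintype_le1P.
      move=> a b.
      by have := ij a; have := ij b; rewrite !negbK => /eqP -> /eqP ->.
    by move=> /existsP.
  have io : orthonormal_pair (delta_mx 0 i) (delta_mx 0 j : 'rV[R]_d).
    by split; rewrite dotp_delta ?eqxx// eq_sym (negbTE ji).
  have := ae_orthogonal io.
  rewrite (integral_orthonormal mpsi psi_ge0 io eo) => /(_ psi0).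
  by apply: (@filterS _ _ aeF) => v; rewrite dotp_deltal.
have : \forall v \ae mu, forall i, (v : 'rV[R]_d) 0 i = 0 by apply: (@filter_forall _ _ _ _ aeF).
(* A vector with all coordinates zero cannot have norm 1, so the whole space would be a null set. *)
move=> ae0; have [N [mN N0 NT]] : \forall v \ae mu, False.
  move: ae_dotp_eq1 ae0; apply: (@filterS2 _ _ aeF) => v + v0.
  rewrite /dotp big1 => [/eqP|i _]; last by rewrite v0 mul0r.
  by rewrite eq_sym oner_eq0.
have := probability_setT mu.
rewrite (_ : setT = N) ?N0; last by apply/seteqP; split => // v _; exact: NT.
by move/eqP; rewrite eq_sym onee_eq0.
Qed.

End Positivity.
End UniformLaw.

(** * Logarithmic growth factors and their subadditivity defect *)

Section LogFactors.
Context {R : realType}.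
Variable c : R.
Hypothesis c_gt0 : 0 < c.
Implicit Types (x y z : R).

(* The minimum with 1 plays no role on the sphere; it makes the factors bounded
   on the whole space. *)
Definition lgain z : R := ln (1 + c * Num.min 1 z).

Definition lgain_defect (z : R * R) : R :=
  lgain (z.1 ^+ 2) + lgain (z.2 ^+ 2) - lgain (z.1 ^+ 2 + z.2 ^+ 2).

Let min1_ge0 z : 0 <= z -> 0 <= Num.min 1 z.
Proof. by move=> z0; rewrite le_min ler01. Qed.

Let arg_ge0 z : 0 <= z -> 0 <= c * Num.min 1 z.
Proof. by move=> z0; rewrite mulr_ge0 ?min1_ge0// ltW. Qed.

Let arg_gt0 z : 0 <= z -> 0 < 1 + c * Num.min 1 z.
Proof. by move=> z0; rewrite ltr_pwDl// arg_ge0. Qed.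

Lemma lgain_ge0 z : 0 <= z -> 0 <= lgain z.
Proof.
by move=> z0; rewrite ln_ge0// lerDl arg_ge0.
Qed.

Lemma lgain_le z : 0 <= z -> lgain z <= ln (1 + c).
Proof.
move=> z0; rewrite ler_ln ?posrE ?arg_gt0//; last exact: addr_gt0.
by rewrite lerD2l ler_piMr ?ge_min ?lexx// ltW.
Qed.

Lemma expR_lgain z : 0 <= z -> z <= 1 -> expR (lgain z) = 1 + c * z.
Proof.
by move=> z0 z1; rewrite lnK ?posrE ?arg_gt0// min_r.
Qed.

Let lgain_defectE (p q : R) : 0 <= p -> 0 <= q ->
  lgain p + lgain q = ln ((1 + c * Num.min 1 p) * (1 + c * Num.min 1 q)).
Proof. by move=> p0 q0; rewrite lnM// posrE arg_gt0. Qed.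

(** The function min(1, z) is subadditive on nonnegative reals; expanding the product leaves the
    cross term, whose sign decides that of the defect. *)
Let lgain_arg (p q : R) : 0 <= p -> 0 <= q ->
  1 + c * Num.min 1 (p + q) + c ^+ 2 * (Num.min 1 p * Num.min 1 q) <=
  (1 + c * Num.min 1 p) * (1 + c * Num.min 1 q).
Proof.
move=> p0 q0.
have h : Num.min 1 (p + q) <= Num.min 1 p + Num.min 1 q.
  by rewrite /Num.min; case: ifP => ?; case: ifP => ?; case: ifP => ?; lra.
have := ler_wpM2l (ltW c_gt0) h; nra.
Qed.

Lemma lgain_defect_ge0 (z : R * R) : 0 <= lgain_defect z.
Proof.
rewrite /lgain_defect lgain_defectE ?sqr_ge0// subr_ge0 ler_ln ?posrE.
- apply: le_trans (lgain_arg _ _); rewrite ?sqr_ge0// lerDl.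
  by rewrite mulr_ge0 ?sqr_ge0// mulr_ge0// min1_ge0 ?sqr_ge0.
- by rewrite arg_gt0// addr_ge0 ?sqr_ge0.
- by rewrite mulr_gt0// arg_gt0 ?sqr_ge0.
Qed.

Lemma lgain_defect_gt0 x y : x != 0 -> y != 0 -> 0 < lgain_defect (x, y).
Proof.
move=> x0 y0; rewrite /lgain_defect lgain_defectE ?sqr_ge0// subr_gt0 ltr_ln ?posrE.
- apply: lt_le_trans (lgain_arg _ _); rewrite ?sqr_ge0// ltrDl.
  by rewrite !mulr_gt0 ?lt_min ?ltr01 ?exprn_even_gt0.
- by rewrite arg_gt0// addr_ge0 ?sqr_ge0.
- by rewrite mulr_gt0// arg_gt0 ?sqr_ge0.
Qed.

Lemma lgain_defect_le (z : R * R) : lgain_defect z <= 2 * ln (1 + c).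
Proof.
have h1 := lgain_le (sqr_ge0 z.1); have h2 := lgain_le (sqr_ge0 z.2).
have h3 : 0 <= lgain (z.1 ^+ 2 + z.2 ^+ 2).
  by rewrite lgain_ge0// addr_ge0 ?sqr_ge0.
rewrite /lgain_defect; lra.
Qed.

Lemma measurable_lgain : measurable_fun setT lgain.
Proof.
apply: (measurableT_comp (@measurable_ln R)).
by apply: measurable_funD => //; apply: measurable_funM => //; exact: measurable_minr.
Qed.

Lemma measurable_lgain_defect : measurable_fun setT lgain_defect.
Proof.
have m1 : measurable_fun setT (fun z : R * R => z.1 ^+ 2).
  exact: measurable_funX.
have m2 : measurable_fun setT (fun z : R * R => z.2 ^+ 2).
  exact: measurable_funX.
apply: measurable_funB; first apply: measurable_funD.
- exact: (measurableT_comp measurable_lgain).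
- exact: (measurableT_comp measurable_lgain).
- apply: (measurableT_comp measurable_lgain); exact: measurable_funD.
Qed.

End LogFactors.

(** From exp(-x) >= 1 - x one gets exp(x) <= 1 / (1 - x), and (1 - x)(1 + x + 2 x^2) = 1 + x^2 (1 -
    2 x) is at least 1 for x <= 1/2. *)
Lemma expR_le_quadratic (R : realType) (x : R) :
  `|x| <= 2^-1 -> expR x <= 1 + x + 2 * x ^+ 2.
Proof.
rewrite ler_norml => /andP[x1 x2].
have h := expR_ge1Dx (- x); rewrite expRN in h.
have e0 := expR_gt0 x.
have {h} : (1 - x) * expR x <= 1.
  by rewrite -[leRHS](mulVf (lt0r_neq0 e0)) ler_pM2r.
nra.
Qed.

(** * Orthonormal coordinates in the plane of two opinions *)

Section BesselPlane.
Context {R : realType} {d : nat}.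
Implicit Types (u v e f : 'rV[R]_d).

Lemma bessel_le1 e f v : orthonormal_pair e f -> dotp v v = 1 ->
  dotp e v ^+ 2 + dotp f v ^+ 2 <= 1.
Proof.
move=> [e1 f1 ef] v1.
have := dotp_ge0 (v - dotp e v *: e - dotp f v *: f).
rewrite !dotpE e1 f1 v1 ef (dotpC f e) ef (dotpC v e) (dotpC v f); lra.
Qed.

(** The strict inequality makes the sine positive, so the component of [u'] orthogonal to [u] can be
    normalized. *)
Lemma gram_schmidt u u' : dotp u u = 1 -> dotp u' u' = 1 ->
  dotp u u' ^+ 2 < 1 -> exists2 e, orthonormal_pair u e &
    u' = dotp u u' *: u + Num.sqrt (1 - dotp u u' ^+ 2) *: e.
Proof.
move=> u1 u'1 x1; set x := dotp u u' in x1 *; set s := Num.sqrt _.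
have s0 : 0 < s by rewrite sqrtr_gt0 subr_gt0.
have s2 : s ^+ 2 = 1 - x ^+ 2 by rewrite sqr_sqrtr// subr_ge0 ltW.
exists (s^-1 *: (u' - x *: u)).
  split=> //; rewrite !dotpE u1 ?u'1 ?(dotpC u' u) -/x; last first.
    by rewrite mulr1 subrr mulr0.
  transitivity ((1 - x ^+ 2) / s ^+ 2); first by field; exact: lt0r_neq0.
  by rewrite s2 divff// -s2 lt0r_neq0// exprn_gt0.
by rewrite scalerA divff ?lt0r_neq0// scale1r addrC subrK.
Qed.

End BesselPlane.

(** * Mean contraction of a small power of the squared sine *)

Section Contraction.
Context {R : realType} {d : nat}.
Variables (eta : R) (mu : probability (borelRV R d) R).
Hypotheses (eta_gt0 : 0 < eta) (d_ge2 : (2 <= d)%N).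
Hypothesis hmu : uniform_on_sphere mu.
Implicit Types (u v e f : 'rV[R]_d) (alpha : R).

(* [|u + eta <u,v> v|^2 = 1 + gain * <u,v>^2] for unit [u] and [v]. *)
Definition gain : R := 2 * eta + eta ^+ 2.

Lemma gain_gt0 : 0 < gain.
Proof. by rewrite addr_gt0 ?mulr_gt0 ?exprn_gt0. Qed.

Let k := ln (1 + gain).

Let k_gt0 : 0 < k.
Proof. by rewrite ln_gt0// ltrDl gain_gt0. Qed.

Definition sin_pow alpha u u' : R := (1 - dotp u u' ^+ 2) `^ alpha.

Lemma sin_pow_ge0 alpha u u' : 0 <= sin_pow alpha u u'.
Proof. exact: powR_ge0. Qed.

(** The squared sine is multiplied by exp(X) with |X| <= 2k, and exp(alpha X) is expanded to second
    order. The linear term is arranged as a difference of mean zero under the uniform law, minus the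
    defect. *)
Let sin_pow_update_le alpha u u' e v : 0 < alpha -> 4 * k * alpha <= 1 ->
  orthonormal_pair u e -> dotp u' u' = 1 -> dotp v v = 1 ->
  dotp u u' ^+ 2 < 1 ->
  u' = dotp u u' *: u + Num.sqrt (1 - dotp u u' ^+ 2) *: e ->
  sin_pow alpha (update eta u v) (update eta u' v) <=
  sin_pow alpha u u' * (1 + 8 * k ^+ 2 * alpha ^+ 2 +
    alpha * (lgain gain (dotp e v ^+ 2) - lgain gain (dotp u' v ^+ 2)
             - lgain_defect gain (dotp u v, dotp e v))).
Proof.
move=> alpha0 alphak eo u'1 v1 x1 u'E; have [u1 e1 ue] := eo.
rewrite /sin_pow sin2_update// v1 mulr1 -/gain.
set x := dotp u u' in x1 u'E *.
have s2_gt0 : 0 < 1 - x ^+ 2 by rewrite subr_gt0.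
set s := Num.sqrt _ in u'E.
have s2 : s ^+ 2 = 1 - x ^+ 2 by rewrite sqr_sqrtr// ltW.
set a := dotp u v; set y := dotp e v.
have bE : dotp u' v = x * a + s * y by rewrite u'E !dotpE.
have ay1 : a ^+ 2 + y ^+ 2 <= 1 by exact: bessel_le1.
have b1 : dotp u' v ^+ 2 <= 1 by exact: dotp_sqr_le1.
set b := dotp u' v in bE b1 *.
have a1 : a ^+ 2 <= 1 by apply: le_trans ay1; rewrite lerDl sqr_ge0.
have ay0 : 0 <= a ^+ 2 + y ^+ 2 by rewrite addr_ge0 ?sqr_ge0.
pose X := lgain gain (a ^+ 2 + y ^+ 2) - lgain gain (a ^+ 2) - lgain gain (b ^+ 2).
have -> : (1 - x ^+ 2 + gain * (a ^+ 2 + b ^+ 2 - 2 * a * b * x)) /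
    ((1 + gain * a ^+ 2) * (1 + gain * b ^+ 2)) = (1 - x ^+ 2) * expR X.
  rewrite /X !expRD !expRN !(expR_lgain gain_gt0) ?sqr_ge0//.
  rewrite !mulrA -[RHS]mulrA -invfM; congr (_ / _).
  (* Substituting b = x a + s y removes the mixed terms; as s^2 = 1 - x^2, the old squared sine
     factors out. *)
  have -> : a ^+ 2 + b ^+ 2 - 2 * a * b * x = (1 - x ^+ 2) * a ^+ 2 + s ^+ 2 * y ^+ 2.
    by rewrite bE; ring.
  by rewrite s2; ring.
rewrite powRM ?expR_ge0 ?(ltW s2_gt0)// ler_wpM2l ?powR_ge0//.
have -> : expR X `^ alpha = expR (alpha * X).
  by rewrite /powR gt_eqF ?expR_gt0// expRK.
have XE : lgain gain (y ^+ 2) - lgain gain (b ^+ 2) - lgain_defect gain (a, y) = X.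
  by rewrite /lgain_defect /X /=; ring.
rewrite XE.
have l1 := lgain_le gain_gt0 (sqr_ge0 a); have l1' := lgain_ge0 gain_gt0 (sqr_ge0 a).
have l2 := lgain_le gain_gt0 (sqr_ge0 b); have l2' := lgain_ge0 gain_gt0 (sqr_ge0 b).
have l3 := lgain_le gain_gt0 ay0; have l3' := lgain_ge0 gain_gt0 ay0.
have X1 : X <= 2 * k by rewrite /X /k; lra.
have X2 : - (2 * k) <= X by rewrite /X /k; lra.
have aX : `|alpha * X| <= 2^-1.
  rewrite normrM gtr0_norm//.
  have : `|X| <= 2 * k by rewrite ler_norml X2.
  move=> /(ler_wpM2l (ltW alpha0)); lra.
have XX : X ^+ 2 <= 4 * k ^+ 2 by nra.
apply: (le_trans (expR_le_quadratic aX)).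
have := ler_wpM2l (sqr_ge0 alpha) XX; rewrite exprMn; lra.
Qed.

(** Equality in Cauchy-Schwarz makes [u'] a multiple of [u], and parallel opinions stay parallel. *)
Let sin_pow_update0 alpha u u' v : alpha != 0 -> dotp u u = 1 -> dotp u' u' = 1 ->
  dotp u u' ^+ 2 = 1 -> sin_pow alpha (update eta u v) (update eta u' v) = 0.
Proof.
move=> alpha0 u1 u'1 x1; rewrite /sin_pow sin2_update// x1 subrr add0r.
have u'E : u' = dotp u u' *: u.
  apply/eqP; rewrite -subr_eq0; apply/eqP/dotp_eq0.
  by rewrite !dotpE u1 u'1 (dotpC u' u); lra.
have -> : dotp u' v = dotp u u' * dotp u v by rewrite {1}u'E dotpZl.
have -> : dotp u v ^+ 2 + (dotp u u' * dotp u v) ^+ 2 -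
    2 * dotp u v * (dotp u u' * dotp u v) * dotp u u' = 0.
  by rewrite exprMn x1; ring: x1.
by rewrite mulr0 mul0r powR0.
Qed.

Lemma measurable_sin_pow_update alpha {d1} {T : measurableType d1}
    (f g h : T -> 'rV[R]_d) : rmeasurable f -> rmeasurable g -> rmeasurable h ->
  measurable_fun setT
    (fun x => sin_pow alpha (update eta (f x) (h x)) (update eta (g x) (h x))).
Proof.
move=> mf mg mh; apply: (measurableT_comp (measurable_powR _)).
apply: measurable_funB => //; apply: measurable_funX.
by apply: measurable_dotp; exact: rmeasurable_update.
Qed.

Let bounded_integrable (g : borelRV R d -> R) (M : R) :
  measurable_fun setT g -> (forall v, 0 <= g v <= M) ->
  mu.-integrable setT (EFin \o g).
Proof.
move=> mg gM; apply: measurable_bounded_integrable => //.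
  by rewrite [X in (X < _)%E]probability_setT ltry.
exists M; split; first exact: num_real.
move=> r Mr v _ /=; have /andP[g0 gle] := gM v.
by rewrite ger0_norm// (le_trans gle)// ltW.
Qed.

Lemma sin_pow_contraction : exists alpha rho : R,
  [/\ 0 < alpha, 0 <= rho < 1 & forall u u', dotp u u = 1 -> dotp u' u' = 1 ->
   (\int[mu]_v (sin_pow alpha (update eta u (v : 'rV[R]_d))
                              (update eta u' (v : 'rV[R]_d)))%:E <=
    rho%:E * (sin_pow alpha u u')%:E)%E].
Proof.
have d_gt0 : (0 < d)%N by exact: leq_trans d_ge2.
pose e1 : 'rV[R]_d := delta_mx 0 (Ordinal d_gt0).
pose e2 : 'rV[R]_d := delta_mx 0 (Ordinal d_ge2).
have eo : orthonormal_pair e1 e2 by split; rewrite dotp_delta.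
pose psi := lgain_defect gain.
have mpsi : measurable_fun setT psi by exact: measurable_lgain_defect.
have psi0 z : 0 <= psi z by apply: lgain_defect_ge0; exact: gain_gt0.
have psik z : psi z <= 2 * k by apply: lgain_defect_le; exact: gain_gt0.
have mpsiv f1 f2 : measurable_fun setT
    (fun v : borelRV R d => psi (dotp f1 (v : 'rV[R]_d), dotp f2 (v : 'rV[R]_d))).
  apply: (measurableT_comp mpsi).
  by apply: measurable_fun_pair; exact: measurable_dotp_borel.
have ipsi f1 f2 : mu.-integrable setT (EFin \o
    (fun v : borelRV R d => psi (dotp f1 (v : 'rV[R]_d), dotp f2 (v : 'rV[R]_d)))).
  by apply: (@bounded_integrable _ (2 * k)) => // v; rewrite psi0 psik.
(* The mean defect; by invariance any orthonormal pair gives the same value. *)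
pose delta : R := \int[mu]_v psi (dotp e1 (v : 'rV[R]_d), dotp e2 (v : 'rV[R]_d)).
have delta_gt0 : 0 < delta.
  rewrite fine_gt0//; apply/andP; split.
    apply: (integral_orthonormal_gt0 hmu mpsi psi0) => // x y x0 y0.
    by apply: lgain_defect_gt0 => //; exact: gain_gt0.
  have := integrable_fin_num measurableT (ipsi e1 e2).
  by rewrite fin_numElt => /andP[].
(* The first bound keeps |alpha X| <= 1/2, the second makes the quadratic term at most half of the
   gain alpha * delta, and the third keeps the contraction factor nonnegative. *)
pose alpha := Num.min (4 * k)^-1 (Num.min (delta / (16 * k ^+ 2)) delta^-1).
have alpha_gt0 : 0 < alpha.
  by rewrite !lt_min !(invr_gt0, divr_gt0, mulr_gt0, exprn_gt0).
have alpha_k : 4 * k * alpha <= 1.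
  rewrite -ler_pdivlMl ?mulr_gt0// mulr1.
  by rewrite /alpha ge_min lexx.
have alpha_d : 8 * k ^+ 2 * alpha <= delta / 2.
  have : alpha <= delta / (16 * k ^+ 2) by rewrite /alpha !ge_min lexx !orbT.
  rewrite ler_pdivlMr ?mulr_gt0 ?exprn_gt0//; lra.
have alpha_1 : alpha * delta <= 1.
  by rewrite -ler_pdivlMr// div1r /alpha !ge_min lexx !orbT.
exists alpha, (1 - alpha * delta / 2); split => //.
  have := mulr_gt0 alpha_gt0 delta_gt0; lra.
move=> u u' u1 u'1.
have [x1|x1] := ltP (dotp u u' ^+ 2) 1; last first.
  have xE : dotp u u' ^+ 2 = 1.
    by apply/le_anti; rewrite x1 dotp_sqr_le1.
  under eq_integral do rewrite sin_pow_update0 ?gt_eqF//.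
  by rewrite integral0 /sin_pow xE subrr powR0 ?gt_eqF// mule0.
have [e ue u'E] := gram_schmidt u1 u'1 x1.
pose l f (v : borelRV R d) := lgain gain (dotp f (v : 'rV[R]_d) ^+ 2).
have ml f : measurable_fun setT (l f).
  apply: (measurableT_comp (@measurable_lgain _ gain)).
  by apply: measurable_funX; exact: measurable_dotp_borel.
have l0 f v : 0 <= l f v by apply: lgain_ge0; [exact: gain_gt0|exact: sqr_ge0].
have lk f v : l f v <= k by apply: lgain_le; [exact: gain_gt0|exact: sqr_ge0].
have il f : mu.-integrable setT (EFin \o l f).
  by apply: (@bounded_integrable _ k) => // v; rewrite l0 lk.
pose p v := psi (dotp u (v : 'rV[R]_d), dotp e (v : 'rV[R]_d)).
pose K := 1 + 8 * k ^+ 2 * alpha ^+ 2.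
pose g := sin_pow alpha u u'.
have g0 : 0 <= g by exact: sin_pow_ge0.
have ip : mu.-integrable setT (EFin \o p) by exact: ipsi.
have ilB : mu.-integrable setT (EFin \o (fun v => l e v - l u' v)).
  exact: (@integrableB _ _ _ mu _ measurableT _ _ (il e) (il u')).
have iB : mu.-integrable setT (EFin \o (fun v => l e v - l u' v - p v)).
  exact: (@integrableB _ _ _ mu _ measurableT _ _ ilB (ipsi u e)).
have iaB : mu.-integrable setT (EFin \o (fun v => alpha * (l e v - l u' v - p v))).
  exact: (@integrableZl _ _ _ mu _ measurableT alpha _ iB).
have iK : mu.-integrable setT (EFin \o (fun _ : borelRV R d => K)).
  exact: finite_measure_integrable_cst.
have iKB : mu.-integrable setT
    (EFin \o (fun v => K + alpha * (l e v - l u' v - p v))).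
  exact: (@integrableD _ _ _ mu _ measurableT _ _ iK iaB).
have igB : mu.-integrable setT
    (EFin \o (fun v => g * (K + alpha * (l e v - l u' v - p v)))).
  exact: (@integrableZl _ _ _ mu _ measurableT g _ iKB).
have le_bound : (\int[mu]_v (sin_pow alpha (update eta u (v : 'rV[R]_d))
      (update eta u' (v : 'rV[R]_d)))%:E <=
    \int[mu]_v (g * (K + alpha * (l e v - l u' v - p v)))%:E)%E.
  apply: ae_ge0_le_integral => //.
  - by move=> v _; rewrite lee_fin sin_pow_ge0.
  - apply/measurable_EFinP; apply: measurable_sin_pow_update.
    + exact: rmeasurable_cst.
    + exact: rmeasurable_cst.
    + exact: rmeasurable_borel.
  - move=> v _; rewrite lee_fin mulr_ge0//.
    (* The comparison of integrals needs a nonnegative majorant for every [v]; here 3 k alpha <=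
       3/4. *)
    have : - (3 * k) <= l e v - l u' v - p v.
      have := l0 e v; have := lk u' v; rewrite /p.
      by have := psik (dotp u v, dotp e v); lra.
    move=> /(ler_wpM2l (ltW alpha_gt0)).
    have : 0 <= 8 * k ^+ 2 * alpha ^+ 2 by rewrite mulr_ge0 ?sqr_ge0// mulr_ge0 ?sqr_ge0.
    rewrite /K; lra.
  - exact: measurable_int igB.
  - have aeF : Filter (nbhs (almost_everywhere mu)) by exact: ae_filter_ringOfSetsType.
    move: (ae_dotp_eq1 hmu); apply: (@filterS _ _ aeF) => v v1 _.
    by rewrite lee_fin; exact: sin_pow_update_le.
apply: (le_trans le_bound).
have RintE (h : borelRV R d -> R) : mu.-integrable setT (EFin \o h) ->
    (\int[mu]_v (h v)%:E)%E = (\int[mu]_v h v)%:E.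
  by move=> ih; rewrite fineK//; exact: (integrable_fin_num measurableT ih).
rewrite RintE// -EFinM lee_fin RintegralZl// mulrC ler_wpM2r//.
rewrite RintegralD// RintegralZl//. rewrite (RintegralB measurableT ilB ip) RintegralB//.
(* Both [e] and [u'] are unit vectors, so these means cancel and only -alpha * delta remains at
   first order. *)
have -> : \int[mu]_v l e v = \int[mu]_v l u' v.
  have [_ e1' _] := ue.
  congr fine; apply: (integral_unit hmu (h := fun z => lgain gain (z ^+ 2))) => //.
    by apply: (measurableT_comp (@measurable_lgain _ gain)); exact: measurable_funX.
  by move=> z; apply: lgain_ge0; [exact: gain_gt0|exact: sqr_ge0].
have -> : \int[mu]_v p v = delta.
  by congr fine; exact: (integral_orthonormal hmu mpsi psi0).
rewrite Rintegral_cst//.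
have -> : fine (mu setT) = 1 by rewrite probability_setT.
have := ler_wpM2l (ltW alpha_gt0) alpha_d.
rewrite /K; lra.
Qed.

End Contraction.

(** * Freezing of the sign and convergence of the inner product *)

Section Alignment.
Context {R : realType} {d : nat}.
Variable eta : R.
Hypothesis eta_gt0 : 0 < eta.
Implicit Types (u v : 'rV[R]_d).

(** Projecting u - u' and u + u' on [v] bounds (a - b)^2 by 2 - 2x and (a + b)^2 by 2 + 2x, and 4ab
    is the difference of the two squares. *)
Lemma dotp_prod_bounds u u' v : dotp u u = 1 -> dotp u' u' = 1 -> dotp v v = 1 ->
  - (1 - dotp u u') <= dotp u v * dotp u' v <= 1 + dotp u u'.
Proof.
move=> u1 u'1 v1.
have h1 := dotp_ge0 ((u - u') - dotp (u - u') v *: v).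
have h2 := dotp_ge0 ((u + u') - dotp (u + u') v *: v).
move: h1 h2; rewrite !dotpE u1 u'1 v1 (dotpC u' u) (dotpC v u) (dotpC v u').
have := sqr_ge0 (dotp u v - dotp u' v); have := sqr_ge0 (dotp u v + dotp u' v).
move: (dotp u v) (dotp u' v) (dotp u u') => a b x.
by move=> ? ? ? ?; apply/andP; split; nra.
Qed.

(** The new product has the sign of x + c a b. If x > 0 this is at least x - c (1 - x), which is
    positive because (1 + c)(1 - x) <= (1 + c)(1 - x^2) < 1; the case x < 0 is symmetric, and x = 0
    contradicts the smallness assumption. *)
Lemma sgr_dotp_update u u' v : dotp u u = 1 -> dotp u' u' = 1 -> dotp v v = 1 ->
  (1 + gain eta) * (1 - dotp u u' ^+ 2) < 1 ->
  Num.sg (dotp (update eta u v) (update eta u' v)) = Num.sg (dotp u u').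
Proof.
move=> u1 u'1 v1 xc; have := dotp_prod_bounds u1 u'1 v1.
rewrite dotp_update// v1 mulr1 -/(gain eta).
have c0 := gain_gt0 eta_gt0.
have den a : 0 < Num.sqrt (1 + gain eta * a ^+ 2).
  by rewrite sqrtr_gt0 ltr_pwDl// mulr_ge0 ?sqr_ge0// ltW.
rewrite sgrM sgrV [X in _ * X = _]gtr0_sg ?mulr1 ?mulr_gt0//.
move: xc; rewrite -[_ * _ * dotp u' v]mulrA.
have := dotp_sqr_le1 u1 u'1.
move: (dotp u v * dotp u' v) (dotp u u') c0 => ab x; move: (gain eta) => c c0.
move=> x1 xc /andP[ab1 ab2].
have [x0|x0|x0] := ltgtP x 0.
- rewrite (ltr0_sg x0); apply: ltr0_sg.
  have := ler_wpM2l (ltW c0) ab2; nra.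
- rewrite (gtr0_sg x0); apply: gtr0_sg.
  have := ler_wpM2l (ltW c0) ab1; nra.
- by move: xc; rewrite x0 expr0n subr0 mulr1; lra.
Qed.

Lemma sphere_opinion (w : nat -> 'rV[R]_d) u t :
  sphere R d u -> sphere R d (opinion eta w u t).
Proof. by move=> u1; elim: t => //= t IH; exact: sphere_update. Qed.

Lemma dotp_opinion_cvg (w : nat -> 'rV[R]_d) u u' :
  (forall t, dotp (w t) (w t) = 1) -> sphere R d u -> sphere R d u' ->
  (fun t => 1 - dotp (opinion eta w u t) (opinion eta w u' t) ^+ 2) @ \oo --> 0 ->
  (fun t => dotp (opinion eta w u t) (opinion eta w u' t)) @ \oo --> (1 : R) \/
  (fun t => dotp (opinion eta w u t) (opinion eta w u' t)) @ \oo --> (-1 : R).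
Proof.
move=> w1 u1 u'1; set x := fun t => dotp _ _ => s0.
have c0 := gain_gt0 eta_gt0.
have op1 z t : sphere R d z -> dotp (opinion eta w z t) (opinion eta w z t) = 1.
  by move=> z1; apply/sphereP; exact: sphere_opinion.
have x2 t : x t ^+ 2 <= 1 by apply: dotp_sqr_le1; exact: op1.
have [N _ sN] : \forall t \near \oo, (1 + gain eta) * (1 - x t ^+ 2) < 1.
  have e0 : 0 < (1 + gain eta)^-1 by rewrite invr_gt0 addr_gt0.
  move/cvgrPdist_lt : s0 => /(_ _ e0); apply: filterS => t /=.
  rewrite sub0r normrN ger0_norm; last by rewrite subr_ge0; exact: x2.
  move=> h.
  by rewrite -ltr_pdivlMl ?mulr1// addr_gt0.
have sgE t : (N <= t)%N -> Num.sg (x t) = Num.sg (x N).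
  elim: t => [|t IH]; first by rewrite leqn0 => /eqP->.
  rewrite leq_eqVlt => /orP[/eqP->//|]; rewrite ltnS => Nt.
  rewrite -IH// /x /=; apply: sgr_dotp_update; rewrite ?op1//.
  exact: (sN t Nt).
(* Once the sign is fixed, the distance to the limit s of that sign is 1 - |x|, which is at most 1 -
   x^2. *)
have cvg_to (s : R) : (forall t, (N <= t)%N -> `|s - x t| <= 1 - x t ^+ 2) ->
    x @ \oo --> s.
  move=> h; apply/cvgrPdist_le => e e0.
  move/cvgrPdist_le : s0 => /(_ _ e0) s0.
  near=> t; have Nt : (N <= t)%N by near: t; exact: nbhs_infty_ge.
  apply: (le_trans (h t Nt)).
  rewrite -[leLHS]ger0_norm ?subr_ge0// -[X in `|X|]opprK normrN -sub0r.
  by near: t.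
have [xN|xN] := ltP 0 (x N); [left|right]; apply: cvg_to => t Nt.
- have xt : 0 < x t by rewrite -sgr_cp0 sgE// sgr_cp0.
  move: (x t) xt (x2 t) => y y0 y2; have y1 : y <= 1 by nra.
  by rewrite ger0_norm ?subr_ge0//; nra.
- have xt : x t <= 0 by rewrite -sgr_le0 sgE// sgr_le0.
  move: (x t) xt (x2 t) => y y0 y2; have y1 : -1 <= y by nra.
  by rewrite ler0_norm ?subr_le0//; nra.
Unshelve. all: by end_near. Qed.

End Alignment.

(** * Almost sure convergence from geometric decay of the means *)

Section Summability.
Context {R : realType} {dO : measure_display} {Omega : measurableType dO}.
Variable P : probability Omega R.

(** The series of the [f t] has a mean bounded by a geometric series, so it is finite almost
    everywhere and its terms tend to 0. *)
Lemma ae_cvg0_geometric (f : nat -> Omega -> R) (rho : R) :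
  0 <= rho < 1 -> (forall t, measurable_fun setT (f t)) ->
  (forall t omega, 0 <= f t omega) ->
  (forall t, \int[P]_omega (f t.+1 omega)%:E <=
             rho%:E * \int[P]_omega (f t omega)%:E)%E ->
  (\int[P]_omega (f 0%N omega)%:E < +oo)%E ->
  \forall omega \ae P, f ^~ omega @ \oo --> (0 : R).
Proof.
move=> /andP[rho0 rho1] mf f0 frho foo.
have mEf t : measurable_fun setT (fun omega => (f t omega)%:E).
  exact/measurable_EFinP.
have Ef0 t omega : (0 <= (f t omega)%:E)%E by rewrite lee_fin.
have int0 t : (0 <= \int[P]_omega (f t omega)%:E)%E by exact: integral_ge0.
pose g := fine (\int[P]_omega (f 0%N omega)%:E)%E.
have gE : (\int[P]_omega (f 0%N omega)%:E = g%:E)%E.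
  by rewrite fineK// ge0_fin_numE.
have g0 : 0 <= g by exact: fine_ge0.
have le_geom t : (\int[P]_omega (f t omega)%:E <= (g * rho ^+ t)%:E)%E.
  elim: t => [|t IH]; first by rewrite gE expr0 mulr1.
  apply: (le_trans (frho t)); apply: (le_trans (lee_wpmul2l _ IH)).
    by rewrite lee_fin.
  by rewrite -EFinM lee_fin exprS mulrCA.
have sum_lt : (\int[P]_omega (\sum_(0 <= t <oo) (f t omega)%:E) < +oo)%E.
  rewrite integral_nneseries//.
  apply: (@le_lt_trans _ _ (g / (1 - rho))%:E); last exact: ltry.
  apply: lime_le; first exact: is_cvg_nneseries.
  apply: nearW => n.
  (* The exact geometric partial sum is what makes the induction on [n] close. *)
  apply: (@le_trans _ _ (g * (1 - rho ^+ n) / (1 - rho))%:E).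
    elim: n => [|n IH]; first by rewrite big_nil expr0 subrr mulr0 mul0r.
    rewrite big_nat_recr//=; apply: (le_trans (leeD IH (le_geom n))).
    rewrite -EFinD lee_fin exprS le_eqVlt; apply/orP; left; apply/eqP.
    by field; rewrite subr_eq0 eq_sym lt_eqF.
  rewrite lee_fin ler_pM2r ?invr_gt0 ?subr_gt0// ler_piMr//.
  by rewrite lerBlDr lerDl exprn_ge0.
have mS : measurable_fun setT (fun omega => \sum_(0 <= t <oo) (f t omega)%:E)%E.
  exact: ge0_emeasurable_sum.
have iS : P.-integrable setT (fun omega => \sum_(0 <= t <oo) (f t omega)%:E)%E.
  apply/integrableP; split => //.
  under eq_integral do rewrite gee0_abs ?nneseries_ge0//.
  exact: sum_lt.
have := integrable_ae measurableT iS.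
apply: filterS => omega /(_ I) Sfin.
have Slt : (\sum_(0 <= t <oo | xpredT t) (f t omega)%:E < +oo)%E.
  by move: Sfin; rewrite fin_numElt => /andP[].
have := nneseries_tail_cvg Slt (fun t _ => Ef0 t omega).
move=> tail0.
have : (fun t => (f t omega)%:E) @ \oo --> 0%E.
  apply: (@squeeze_cvge _ _ _ _ (cst 0%E) _ _ _ _ _ tail0); last exact: cvg_cst.
  apply: nearW => t; rewrite /= Ef0 /=.
  rewrite (@nneseries_split_cond _ _ t 1)//.
  rewrite addn1 big_nat1 leeDl//; exact: nneseries_ge0.
by move/fine_cvgP => [].
Qed.

End Summability.

(** * Almost sure polarization of two opinions *)

Section PairPolarization.
Context {R : realType} {d : nat}.
Variables (eta : R) (mu : probability (borelRV R d) R).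
Hypotheses (eta_gt0 : 0 < eta) (d_ge2 : (2 <= d)%N).
Hypothesis hmu : uniform_on_sphere mu.
Context {dO : measure_display} {Omega : measurableType dO}.
Variables (P : probability Omega R) (v : nat -> {RV P >-> borelRV R d}).
Hypothesis hv : iid_with_law v mu.

Let path omega : nat -> 'rV[R]_d := fun s => v s omega.

Lemma ae_path_unit :
  \forall omega \ae P, forall t, dotp (path omega t) (path omega t) = 1.
Proof.
apply: ae_foralln => t.
have [N [mN N0 unitN]] := ae_dotp_eq1 hmu.
exists (v t @^-1` N); split.
- by rewrite -[X in measurable X]setTI; exact: measurable_funPT.
- by have [_ /(_ t N mN)] := hv; rewrite N0.
- by move=> omega; exact: unitN.
Qed.

(** The two opinions share their interventions, so the pair is treated as a single driven chain. *)
Let state := (coordRV R d * coordRV R d)%type.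

Let step (z : state * borelRV R d) : state :=
  (update eta (z.1.1 : 'rV[R]_d) (z.2 : 'rV[R]_d),
   update eta (z.1.2 : 'rV[R]_d) (z.2 : 'rV[R]_d)).

Let rm_fst : rmeasurable (fun z : state * borelRV R d => z.1.1 : 'rV[R]_d).
Proof.
move=> i; apply: (measurableT_comp (@rmeasurable_coordRV R d i)).
exact: (measurableT_comp measurable_fst measurable_fst).
Qed.

Let rm_snd : rmeasurable (fun z : state * borelRV R d => z.1.2 : 'rV[R]_d).
Proof.
move=> i; apply: (measurableT_comp (@rmeasurable_coordRV R d i)).
exact: (measurableT_comp measurable_snd measurable_fst).
Qed.

Let rm_v : rmeasurable (fun z : state * borelRV R d => z.2 : 'rV[R]_d).
Proof.
by move=> i; apply: (measurableT_comp (@rmeasurable_borel R d i)).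
Qed.

Let measurable_step : measurable_fun setT step.
Proof.
by apply: measurable_fun_pair; apply: measurable_to_coordRV;
  exact: rmeasurable_update.
Qed.

Lemma ae_sin_cvg0 u u' : sphere R d u -> sphere R d u' ->
  \forall omega \ae P,
    (fun t => 1 - dotp (opinion eta (path omega) u t)
                       (opinion eta (path omega) u' t) ^+ 2) @ \oo --> (0 : R).
Proof.
move=> u1 u'1.
have [alpha [rho [alpha0 rho01 contr]]] := sin_pow_contraction eta_gt0 d_ge2 hmu.
pose X := chain v step (u, u').
have XE t omega : X t omega =
    (opinion eta (path omega) u t, opinion eta (path omega) u' t).
  by elim: t => //= t; rewrite /X /= => ->.
have mX t : measurable_fun setT (X t) by exact: measurable_chain.
pose f t omega := sin_pow alpha (X t omega).1 (X t omega).2.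
have mf t : measurable_fun setT (f t).
  apply: (measurableT_comp (measurable_powR _)).
  apply: measurable_funB => //; apply: measurable_funX; apply: measurable_dotp => i.
    apply: (measurableT_comp (@rmeasurable_coordRV R d i)).
    exact: (measurableT_comp measurable_fst (mX t)).
  apply: (measurableT_comp (@rmeasurable_coordRV R d i)).
  exact: (measurableT_comp measurable_snd (mX t)).
have f0 t omega : 0 <= f t omega by exact: sin_pow_ge0.
have [indep law] := hv.
have contrf t : (\int[P]_omega (f t.+1 omega)%:E <=
    rho%:E * \int[P]_omega (f t omega)%:E)%E.
  pose h (z : state * borelRV R d) := (sin_pow alpha
    (update eta (z.1.1 : 'rV[R]_d) (z.2 : 'rV[R]_d))
    (update eta (z.1.2 : 'rV[R]_d) (z.2 : 'rV[R]_d)))%:E.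
  have mh : measurable_fun setT h.
    by apply/measurable_EFinP; exact: measurable_sin_pow_update.
  have h0 z : (0 <= h z)%E by rewrite lee_fin sin_pow_ge0.
  rewrite (_ : (\int[P]_omega (f t.+1 omega)%:E)%E =
               (\int[P]_omega h (X t omega, v t omega))%E); last by [].
  (* The fresh intervention is integrated out first; the contraction then applies at each fixed
     state. *)
  rewrite (@integral_chain _ _ _ _ _ _ _ P v step (u, u') measurable_step
    indep t mu h (law t) mh h0).
  rewrite -ge0_integralZl_EFin//; last 3 first.
  - by move=> omega _; rewrite lee_fin.
  - exact/measurable_EFinP.
  - by case/andP: rho01.
  apply: ge0_le_integral => //.
  - by move=> omega _; exact: integral_ge0.
  - have mF : measurable_fun setT (fubini_F mu h).
      exact: measurable_fun_fubini_tonelli_F.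
    exact: (measurableT_comp mF (mX t)).
  - by apply: measurable_funeM; exact/measurable_EFinP.
  - move=> omega _; rewrite /f; rewrite /h -/(X t omega) XE /=.
    by apply: contr; apply/sphereP; exact: sphere_opinion.
have f0oo : (\int[P]_omega (f 0%N omega)%:E < +oo)%E.
  rewrite (_ : (\int[P]_omega _)%E = ((sin_pow alpha u u')%:E * P setT)%E).
    by rewrite probability_setT mule1 ltry.
  by rewrite -[RHS](integral_cst P measurableT).
have := ae_cvg0_geometric rho01 mf f0 contrf f0oo.
apply: filterS => omega fcvg.
apply/cvgrPdist_lt => e e0.
(* The power is undone by monotonicity: a squared sine of at least [e] would have its power at least
   [e] to the [alpha]. *)
have ea0 : 0 < e `^ alpha by exact: powR_gt0.
move/cvgrPdist_lt : fcvg => /(_ _ ea0); apply: filterS => t.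
rewrite !sub0r !normrN (ger0_norm (f0 _ _)).
have s0 : 0 <= 1 - dotp (opinion eta (path omega) u t)
                        (opinion eta (path omega) u' t) ^+ 2.
  by rewrite subr_ge0 dotp_sqr_le1//; apply/sphereP; exact: sphere_opinion.
rewrite /f XE /sin_pow /= ger0_norm// !ltNge; apply: contraNN => es.
by apply: ge0_ler_powR => //; rewrite ?nnegrE ltW.
Qed.

End PairPolarization.

(** * Diameter bound from alignment with one reference vector *)

Section Diameter.
Context {R : realType} {d : nat}.

Lemma ediam_le (I : finType) (p : I -> 'rV[R]_d) (q : 'rV[R]_d) :
  (0 < #|I|)%N -> dotp q q = 1 -> (forall i, dotp (p i) (p i) = 1) ->
  0 <= ediam [set p i | i in [set: I]] <=
    Num.sqrt (8 * \sum_i (1 - dotp q (p i))).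
Proof.
move=> /card_gt0P[i0 _] q1 p1.
have qp0 i : 0 <= 1 - dotp q (p i).
  by have := dotp_sqr_le1 q1 (p1 i); nra.
set S := \sum_i _.
have leS i : 1 - dotp q (p i) <= S.
  by rewrite /S (bigD1 i)//= lerDl sumr_ge0.
rewrite /ediam; set D := (X in sup X).
have DS : ubound D (Num.sqrt (8 * S)).
  move=> _ [_ [i _ <-] [_ [j _ <-] <-]]; rewrite /enorm ler_wsqrtr//.
  (* By the parallelogram law |p_i - p_j|^2 <= 2 |p_i - q|^2 + 2 |p_j - q|^2, and |p_i - q|^2 = 2 (1
     - <q,p_i>); this produces the constant 8. *)
  have := dotp_ge0 ((p i - q) + (p j - q)).
  rewrite !dotpE q1 !p1 !(dotpC (p _) q) (dotpC (p j) (p i)).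
  by have := leS i; have := leS j; lra.
(* Nonemptiness makes [sup] the true supremum, and the element 0 gives the lower bound. *)
have D0 : D 0.
  exists (p i0); first by exists i0.
  exists (p i0); first by exists i0.
  by rewrite subrr /enorm -(scale0r 0) dotpZl mul0r sqrtr0.
apply/andP; split.
- by apply: ub_le_sup D0; exists (Num.sqrt (8 * S)).
- by apply: ge_sup => //; exists 0.
Qed.

End Diameter.

(** * Alignment of all opinions, up to sign, with the first one *)

Theorem corollary3p1 (R : realType) (d : nat) (eta : R) (n : nat)
    (hd : (2 <= d)%N) (heta : 0 < eta) (hn : (1 <= n)%N)
    (u1 : 'I_n -> 'rV[R]_d) (hu1 : forall i, sphere R d (u1 i))
    (dO : measure_display) (Omega : measurableType dO)
    (P : probability Omega R)
    (v : nat -> {RV P >-> borelRV R d})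
    (mu : probability (borelRV R d) R)
    (hmu : uniform_on_sphere mu)
    (hv : iid_with_law v mu) :
  {ae P, forall omega, exists J : {set 'I_n},
    ediam [set (-1) ^+ (i \in J) *: opinion eta (fun s => v s omega) (u1 i) t
          | i in [set: 'I_n]] @[t --> \oo] --> (0 : R)}.
Proof.
pose i0 : 'I_n := Ordinal hn.
have : \forall omega \ae P, forall i,
    (fun t => 1 - dotp (opinion eta (fun s => v s omega) (u1 i0) t)
       (opinion eta (fun s => v s omega) (u1 i) t) ^+ 2) @ \oo --> (0 : R).
  by apply: filter_forall => i; exact: (ae_sin_cvg0 heta hd hmu hv).
have := ae_path_unit hmu hv; apply: filterS2 => omega v1 s0.
set w := fun s => _ in s0 *.
pose x i t := dotp (opinion eta w (u1 i0) t) (opinion eta w (u1 i) t).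
pose J : {set 'I_n} := [set i | `[< x i @ \oo --> (-1 : R) >]]%SET.
exists J.
have xJ i : (-1) ^+ (i \in J) * x i t @[t --> \oo] --> (1 : R).
  rewrite inE; case: asboolP => xi.
    have h : (-1) ^+ true * x i t @[t --> \oo] --> (-1) ^+ true * (-1 : R).
      by apply: cvgM => //; exact: cvg_cst.
    have E : (-1) ^+ true * -1 = 1 :> R by rewrite expr1 mulrNN mulr1.
    by rewrite E in h.
  (* Outside [J] the limit -1 is excluded, and the dichotomy leaves the limit 1. *)
  under eq_fun do rewrite expr0 mul1r.
  by have [//|/xi] := dotp_opinion_cvg heta v1 (hu1 i0) (hu1 i) (s0 i).
have sum0 : Num.sqrt (8 * \sum_i (1 - (-1) ^+ (i \in J) * x i t)) @[t --> \oo] --> (0 : R).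
  rewrite -[X in _ --> X]sqrtr0; apply: continuous_cvg; first exact: sqrt_continuous.
  rewrite -[X in _ --> X](mulr0 8); apply: cvgM; first exact: cvg_cst.
  have sum_cvg : \sum_i (1 - (-1) ^+ (i \in J) * x i t) @[t --> \oo] -->
      (\sum_(i < n) (1 - 1) : R).
    apply: (cvg_big (@add_continuous R)) => i _.
    by apply: cvgB; [exact: cvg_cst|exact: xJ].
  by rewrite subrr big1 in sum_cvg.
apply: (squeeze_cvgr _ (cvg_cst 0) sum0).
apply: nearW => t.
have op1 i : dotp (opinion eta w (u1 i) t) (opinion eta w (u1 i) t) = 1.
  by apply/sphereP; exact: sphere_opinion.
have := @ediam_le R d 'I_n
  (fun i => (-1) ^+ (i \in J) *: opinion eta w (u1 i) t) (opinion eta w (u1 i0) t).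
under eq_bigr do rewrite dotpZr.
apply => //; first by rewrite card_ord.
by move=> i; rewrite dotpZl dotpZr op1 mulr1 -expr2 sqrr_sign.
Qed.
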